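(* Let $\mathcal{S}$ be an $F$-weighted boundary stratum of genus $g$ whose weights contain exactly $n$ distinct weights up to sign, $r_1,\dots,r_n$. Then $r_1\otimes r_1,\dots,r_n\otimes r_n$ are linearly independent over $\mathbb{Q}$ in $\mathrm{Sym}_{\mathbb{Q}}(F)$. Equivalently, $N(\mathcal{S})$ (as a $\mathbb{Q}$-vector space) and the torus $A_\mathcal{S}$ have dimension $g(g+1)/2-n$.
   Context: $F$ is a totally real number field of degree $g$ with trace pairing $\langle x,y\rangle=\mathrm{Tr}_{F/\mathbb{Q}}(xy)$. For a lattice $\mathcal{I}\subset F$ (additive subgroup of rank $g$), $\mathcal{I}^\vee=\{x\in F:\langle x,y\rangle\in\mathbb{Z}\ \forall y\in\mathcal{I}\}$. An $\mathcal{I}$-weighted stable curve is a stable curve of arithmetic genus $g$ and geometric genus $0$ with an element of $\mathcal{I}$ attached to each branch at each node, such that the two branches at a node have opposite weights, the weights on each component sum to zero, and the weights span $\mathcal{I}$; ''$F$-weighted'' means $\mathcal{I}$-weighted for some lattice $\mathcal{I}$. An $F$-weighted boundary stratum $\mathcal{S}$ is the moduli space of weighted stable curves topologically equivalent (weight-preservingly) to a fixed one; its weights are those of its nodes. $\mathrm{Sym}_{\mathbb{Q}}(F)\subset F\otimes_{\mathbb{Q}}F$ is the subspace of symmetric tensors, $\mathbf{S}_{\mathbb{Q}}(F)$ is the quotient of $F\otimes_{\mathbb{Q}}F$ by the span of $x\otimes y-y\otimes x$, and they are dual via $\langle a\otimes b,c\otimes d\rangle=\langle a,c\rangle\langle b,d\rangle$;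 $\mathbf{S}_{\mathbb{Z}}(\mathcal{I}^\vee)$ is the analogous quotient of $\mathcal{I}^\vee\otimes_{\mathbb{Z}}\mathcal{I}^\vee$. $W(\mathcal{S})\subset\mathrm{Sym}_{\mathbb{Q}}(F)$ is the span of $r\otimes r$ over the weights $r$ of $\mathcal{S}$, $N(\mathcal{S})\subset\mathbf{S}_{\mathbb{Q}}(F)$ its annihilator, and $A_\mathcal{S}=\mathrm{Hom}_{\mathbb{Z}}(N(\mathcal{S})\cap\mathbf{S}_{\mathbb{Z}}(\mathcal{I}^\vee),\mathbb{G}_m)$ the ambient algebraic torus.
   Formalization: Here r_1,…,r_n are the distinct nonzero weights up to sign (a separating node has weight 0, and 0⊗0=0 would break independence); the dimension is stated for N(S) only, that of the torus A_S being the rank of a lattice in N(S). *)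

(* Defs.v *)
From HB Require Import structures.
From mathcomp Require Import all_boot all_order all_algebra all_field.
Set Implicit Arguments. Unset Strict Implicit. Unset Printing Implicit Defensive.
Import Order.TTheory GRing.Theory Num.Theory.
Local Open Scope ring_scope.

(* F is modelled as a finite-dimensional field extension L of Q.
   We fix the Q-basis eF := vbasis of L; F (x) F is identified with
   'M[rat]_(d,d) (d = [L:Q]) via coordinates in that basis. *)

Section Tensors.
Variable L : fieldExtType rat.
Local Notation d := (\dim {:L}).

Definition eF : d.-tuple L := vbasis fullv.

Definition trF (x : L) : rat := \tr (passmx.mxof eF eF (amulr x)).

Definition totally_real : Prop :=
  forall (f : {rmorphism L -> algC}) (x : L), f x \is Num.real.

Definition tens (x y : L) : 'M[rat]_d :=
  \matrix_(i, j) (coord eF i x * coord eF j y).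

(* the pairing <a(x)b, c(x)d> = <a,c><b,d>, extended bilinearly *)
Definition tpair (T U : 'M[rat]_d) : rat :=
  \sum_(i < d) \sum_(j < d) \sum_(k < d) \sum_(l < d)
    T i j * U k l * trF (eF`_i * eF`_k) * trF (eF`_j * eF`_l).

(* span of x (x) y - y (x) x : the kernel of F(x)F -> S_Q(F) *)
Definition asymV : {vspace 'M[rat]_d} :=
  <<[seq tens eF`_i eF`_j - tens eF`_j eF`_i | i : 'I_d <- enum 'I_d, j : 'I_d <- enum 'I_d]>>%VS.

Definition annV (s : seq 'M[rat]_d) : {vspace 'M[rat]_d} :=
  lker (linfun (fun T : 'M[rat]_d => \row_(i < size s) tpair T s`_i)).

End Tensors.

(* Weighted stable curve of geometric genus 0, encoded by its weighted dual
   graph: vertices V (rational components), half-edges (branches at nodes) H,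
   vert h = component carrying branch h, iota = the other branch of the same
   node, w h = weight of branch h. *)
Definition adjV (V H : finType) (vert : H -> V) (iota : H -> H) : rel V :=
  fun u v => [exists h, (vert h == u) && (vert (iota h) == v)].

Definition weighted_stable_curve (L : fieldExtType rat) (g : nat)
    (V H : finType) (vert : H -> V) (iota : H -> H) (w : H -> L) : Prop :=
  [/\
      (forall h, iota (iota h) = h) /\ (forall h, iota h != h),
      (forall u v, connect (adjV vert iota) u v),
      (* stability: every rational component has >= 3 special points *)
      (forall v, 3 <= #|[set h | vert h == v]|)%N,
      (* arithmetic genus = #nodes - #components + 1 = g *)
      (#|H| + 2 = 2 * (g + #|V|))%N &
      (* weights: opposite on the two branches, sum zero on each component,
         and their Z-span is a lattice I (rank-g additive subgroup of L) *)
      [/\ (forall h, w (iota h) = - w h),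
          (forall v, \sum_(h | vert h == v) w h = 0) &
          (exists b : (\dim {:L}).-tuple L, basis_of fullv b /\
             forall x, inIntSpan (in_tuple (map w (enum H))) x <-> inIntSpan b x)]].

Definition weight_squares (L : fieldExtType rat) (H : finType) (w : H -> L) :=
  [seq tens (w h) (w h) | h <- enum H].

(* Main.v *)
(* The weights are the images of the edge classes of the dual graph under an
   isomorphism H^1(graph, Q) -> F (they span F and dim F is the first Betti
   number), so every linear relation between them is a coboundary.  Hence they
   form a unimodular system: modulo the span of any set of weights, a weight that
   is a multiple of another is 0 or plus or minus it.  For a unimodular system
   r_1, ..., r_n with sum_i c_i r_i (x) r_i = 0, one shows by descending induction
   on a subspace K spanned by some of the r_i that the c_i in each nonzero class
   modulo K and up to sign add up to 0; for K = 0 this says that all c_i vanish.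
   The dimension formula follows because the trace form is nondegenerate. *)

Require Import Defs.
From HB Require Import structures.
From mathcomp Require Import all_boot all_order all_algebra all_field.
From mathcomp Require Import ring zify.
Import Order.TTheory GRing.Theory Num.Theory.
Local Open Scope ring_scope.
Set Implicit Arguments. Unset Strict Implicit. Unset Printing Implicit Defensive.

(** * Vector identities through linear functionals *)

Lemma eq_by_functionals (F : fieldType) (vT : vectType F) (x y : vT) :
  (forall f : vT -> F, {morph f : u v / u + v} -> {morph f : u / - u} ->
     (forall a u, f (a *: u) = a * f u) -> f x = f y) -> x = y.
Proof.
move=> xy; rewrite (coord_vbasis (memvf x)) (coord_vbasis (memvf y)).
apply: eq_bigr => i _; congr (_ *: _).
apply: xy => [u v|u|a u]; [exact: linearD|exact: linearN|exact: linearZ].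
Qed.

(* [ring] does not handle module scalars, so vector identities are tested on functionals. *)
Ltac vect_ring :=
  apply: eq_by_functionals;
  let fD := fresh in let fN := fresh in let fZ := fresh in
  intros ? fD fN fZ; rewrite !(fD, fN, fZ); ring.

(** * Unimodular systems of vectors *)

Section Unimodular.
Variables (F : numFieldType) (vT : vectType F).
Implicit Types (K : {vspace vT}) (x y z : vT) (J r : seq vT).

(** Equivalently, with respect to linearly independent vectors of [R], every vector of [R] in their
    span has all its coordinates among 0, 1 and -1. *)
Definition unimodular (R : {pred vT}) : Prop :=
  forall J x y (a : F), {subset J <= R} -> x \in R -> y \in R ->
    x \notin <<J>>%VS -> y - a *: x \in <<J>>%VS -> a \in [:: 0; 1; -1].

Definition eq_up_to_sign K x y := (y - x \in K) || (y + x \in K).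

(** The functional is the coordinate along [x] of the projection onto the line of [x] parallel to
    [K]. *)
Lemma functional_separates K x : x \notin K ->
  exists phi : 'Hom(vT, F^o), (forall u, u \in K -> phi u = 0) /\ phi x = 1.
Proof.
move=> xK.
have x0 : x != 0 by apply: contraNneq xK => ->; apply: mem0v.
have cap : (<[x]> :&: K = 0)%VS.
  apply/eqP; rewrite -subv0; apply/subvP=> u; rewrite memv_cap.
  move=> /andP[/vlineP[a ->]] axK.
  have [->|a0] := eqVneq a 0; first by rewrite scale0r mem0v.
  by move: axK; rewrite rpredZeq (negPf a0) (negPf xK).
pose phi := fun u => coord [tuple x] ord0 (daddv_pi <[x]> K u).
have lphi : linear (phi : vT -> F^o) by move=> a u v; rewrite /phi !linearP.
pose phiM := GRing.isLinear.Build _ _ _ _ (phi : vT -> F^o) lphi.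
pose phiL : {linear vT -> F^o} := HB.pack (phi : vT -> F^o) phiM.
exists (linfun phiL); split=> [u uK|]; rewrite lfunE /= /phi.
  suff -> : daddv_pi <[x]> K u = 0 by rewrite linear0.
  have capC : (K :&: <[x]> = 0)%VS by rewrite capvC.
  have := daddv_pi_add cap (subvP (addvSr <[x]> K) _ uK).
  rewrite (daddv_pi_id capC uK) => /(congr1 (fun v => v - u)).
  by rewrite addrK subrr.
rewrite (daddv_pi_id cap (memv_line x)).
have fx : free [tuple x] by rewrite /= seq1_free.
by have /= -> := coord_free ord0 ord0 fx.
Qed.

Lemma mem_span_cons x y J :
  reflect (exists a, y - a *: x \in <<J>>%VS) (y \in <<x :: J>>%VS).
Proof.
rewrite span_cons; apply: (iffP memv_addP) => [[u /vlineP[a ->] [v vJ ->]]|[a yJ]].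
  by exists a; rewrite addrAC subrr add0r.
by exists (a *: x); [apply/vlineP; exists a | exists (y - a *: x) => //; rewrite addrC subrK].
Qed.

Lemma span_cons_exchange x y J :
  x \notin <<J>>%VS -> y \notin <<x :: J>>%VS -> x \notin <<y :: J>>%VS.
Proof.
move=> xJ; apply: contra => /mem_span_cons[a xyJ].
have a0 : a != 0.
  by apply: contraNneq xJ => a0; move: xyJ; rewrite a0 scale0r subr0.
apply/mem_span_cons; exists a^-1.
have -> : y - a^-1 *: x = - a^-1 *: (x - a *: y).
  by rewrite scalerBr scalerA mulNr mulVf // !scaleNr scale1r opprK addrC.
exact: memvZ.
Qed.

Lemma notin_span_cons x y J : y \notin <<x :: J>>%VS -> y \notin <<J>>%VS.
Proof.
by apply: contra => yJ; apply/mem_span_cons; exists 0; rewrite scale0r subr0.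
Qed.

Lemma independent_mod x y J (a b : F) :
  x \notin <<J>>%VS -> y \notin <<x :: J>>%VS ->
  a *: x + b *: y \in <<J>>%VS -> a = 0 /\ b = 0.
Proof.
move=> xJ yJ abJ.
have b0 : b = 0.
  apply/eqP; apply: contraNT yJ => b0; apply/mem_span_cons; exists (- (b^-1 * a)).
  have -> : y - - (b^-1 * a) *: x = b^-1 *: (a *: x + b *: y).
    by rewrite scaleNr opprK scalerDr !scalerA mulVf // scale1r addrC.
  exact: memvZ.
split=> //; apply/eqP; apply: contraNT xJ => a0.
move: abJ; rewrite b0 scale0r addr0 (rpredZeq _ a) (negPf a0); exact: id.
Qed.

(** If [y - e x] with [e] = 1 or -1 is a multiple [b f] modulo [J], unimodularity modulo [x :: J]
    forces [b] to be 0, 1 or -1. The six pairs [(e, b)] exclude one another, since [x] and [f] are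
    independent modulo [J]; opposite pairs make up the classes of [x], [x + f] and [x - f].
    Exclusivity is what allows an equality of numbers rather than of booleans. *)
Lemma eq_up_to_sign_cons r J x f y :
  unimodular (mem r) -> {subset J <= r} -> x \in r -> f \in r -> y \in r ->
  x \notin <<J>>%VS -> f \notin <<x :: J>>%VS ->
  (eq_up_to_sign <<f :: J>> x y : nat) =
    (eq_up_to_sign <<J>> x y + eq_up_to_sign <<J>> (x + f) y
     + eq_up_to_sign <<J>> (x - f) y)%N.
Proof.
move=> U Jr xr fr yr xJ fJ; have ind := independent_mod xJ fJ.
have key e : y - e *: x \in <<f :: J>>%VS -> e ^+ 2 = 1 ->
    exists2 b, b \in [:: 0; 1; -1] & y - e *: x - b *: f \in <<J>>%VS.
  move=> /mem_span_cons[b yJ] e2; exists b => //.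
  apply: (U (x :: J) f y) => //; first by move=> t; rewrite inE => /predU1P[->//|/Jr].
  apply/mem_span_cons; exists e.
  suff <- : y - e *: x - b *: f = y - b *: f - e *: x by [].
  by vect_ring.
pose m e b := y - e *: x - b *: f \in <<J>>%VS.
have m_uniq e b e' b' : m e b -> (e', b') != (e, b) -> m e' b' = false.
  move=> meb; apply: contraNF => me'b'.
  have /ind[/eqP + /eqP] : (e' - e) *: x + (b' - b) *: f \in <<J>>%VS.
    suff -> : (e' - e) *: x + (b' - b) *: f =
        (y - e *: x - b *: f) - (y - e' *: x - b' *: f) by apply: memvB.
    by vect_ring.
  by rewrite !subr_eq0 xpair_eqE => -> ->.
(* Characteristic 0 keeps the six pairs distinct. *)
have sign1 : ((1 : F) == -1) = false.
  by rewrite -subr_eq0 opprK -[1 + 1]/(1 *+ 2) pnatr_eq0.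
have sign2 : ((-1 : F) == 1) = false by rewrite eq_sym.
have sgnE := (xpair_eqE, sign1, sign2, oppr_eq0, oner_eq0, eqxx,
  eq_sym (0 : F) 1, eq_sym (0 : F) (-1), andbF, andbT).
have clE a : eq_up_to_sign <<J>> (x + a *: f) y = m 1 a || m (-1) (- a).
  rewrite /eq_up_to_sign /m.
  have <- : y - (x + a *: f) = y - 1 *: x - a *: f by vect_ring.
  by have <- : y + (x + a *: f) = y - (-1) *: x - (- a) *: f by vect_ring.
have -> : eq_up_to_sign <<J>> x y = m 1 0 || m (-1) 0.
  by have := clE 0; rewrite scale0r addr0 oppr0.
have -> : eq_up_to_sign <<J>> (x + f) y = m 1 1 || m (-1) (- 1).
  by have := clE 1; rewrite scale1r.
have -> : eq_up_to_sign <<J>> (x - f) y = m 1 (-1) || m (-1) 1.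
  by have := clE (-1); rewrite scaleN1r opprK.
have -> : eq_up_to_sign <<f :: J>> x y =
    [|| m 1 0, m 1 1, m 1 (-1), m (-1) 0, m (-1) 1 | m (-1) (-1)].
  have mem_cons e b : m e b -> y - e *: x \in <<f :: J>>%VS.
    by move=> meb; apply/mem_span_cons; exists b.
  have memN : y + x = y - (-1) *: x by rewrite scaleN1r opprK.
  rewrite /eq_up_to_sign memN -{1}[x]scale1r; apply/idP/idP.
    by case/orP=> /key[|b]; rewrite ?sqrrN ?expr1n // !inE => + meb;
       case/or3P=> /eqP b_eq; move: meb; rewrite b_eq -/(m _ _) => ->; rewrite ?orbT.
  by case/or4P=> [||| /or3P[||]] /mem_cons ->; rewrite ?orbT.
(* Once one pair holds, [m_uniq] refutes the five others and both sides evaluate to 1. *)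
case E1: (m 1 0); first by rewrite !(m_uniq _ _ _ _ E1) ?sgnE.
case E2: (m 1 1); first by rewrite !(m_uniq _ _ _ _ E2) ?sgnE.
case E3: (m 1 (-1)); first by rewrite !(m_uniq _ _ _ _ E3) ?sgnE.
case E4: (m (-1) 0); first by rewrite !(m_uniq _ _ _ _ E4) ?sgnE.
case E5: (m (-1) 1); first by rewrite !(m_uniq _ _ _ _ E5) ?sgnE.
by case: (m _ _).
Qed.

Lemma eq_up_to_sign_trans K x y z :
  eq_up_to_sign K x y -> eq_up_to_sign K y z -> eq_up_to_sign K x z.
Proof.
rewrite /eq_up_to_sign => /orP[] xy /orP[] yz; apply/orP.
- left; have -> : z - x = (z - y) + (y - x) by vect_ring.
  exact: memvD.
- right; have -> : z + x = (z + y) - (y - x) by vect_ring.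
  exact: memvB.
- right; have -> : z + x = (z - y) + (y + x) by vect_ring.
  exact: memvD.
- left; have -> : z - x = (z + y) - (y + x) by vect_ring.
  exact: memvB.
Qed.

Lemma eq_up_to_sign_sym K x y : eq_up_to_sign K x y = eq_up_to_sign K y x.
Proof. by rewrite /eq_up_to_sign -memvN opprB (addrC y). Qed.

(** * Sums of coefficients over classes up to sign *)

Section ClassSums.
Variables (r : seq vT) (c : 'I_(size r) -> F).

(** Here [x] may lie outside [r], as [x + f] and [x - f] can; an empty class has sum 0. *)
Definition class_sum K x := \sum_(i < size r | eq_up_to_sign K x r`_i) c i.

Lemma class_sum_eq K x y : eq_up_to_sign K x y -> class_sum K x = class_sum K y.
Proof.
move=> xy; apply: eq_bigl => i; apply/idP/idP; last exact: eq_up_to_sign_trans.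
by apply: eq_up_to_sign_trans; rewrite eq_up_to_sign_sym.
Qed.

Hypothesis unim : unimodular (mem r).

Lemma class_sum_cons J x f : {subset J <= r} -> x \in r -> f \in r ->
  x \notin <<J>>%VS -> f \notin <<x :: J>>%VS ->
  class_sum <<f :: J>> x =
    class_sum <<J>> x + class_sum <<J>> (x + f) + class_sum <<J>> (x - f).
Proof.
move=> Jr xr fr xJ fJ; rewrite /class_sum.
do 4 rewrite [\sum_(i < _ | eq_up_to_sign _ _ _) _]big_mkcond.
rewrite -!big_split /=; apply: eq_bigr => i _.
have := @eq_up_to_sign_cons r J x f r`_i unim Jr xr fr (mem_nth 0 (ltn_ord i)) xJ fJ.
by do 4!case: (eq_up_to_sign _ _ _) => //=; rewrite ?addr0 ?add0r.
Qed.

(** This is the relation between the tensors [r_i ⊗ r_i], evaluated at [phi ⊗ phi]. *)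
Hypothesis squares0 :
  forall phi : 'Hom(vT, F^o), \sum_(i < size r) c i * phi r`_i ^+ 2 = 0.

(* Modulo an independent pair [x, f] the class of [x] modulo [f] splits as the
   classes of [x], [x + f] and [x - f]; by exchange each nonempty one has the
   same sum as that of [x], so that sum is killed by 1, 2 or 3. *)
Lemma class_sum0 J x : {subset J <= r} -> x \in r -> x \notin <<J>>%VS ->
  class_sum <<J>> x = 0.
Proof.
have [m] := ubnP (\dim {:vT} - \dim <<J>>).
elim: m => // m IHm in J x * => lt_m Jr xr xJ.
have dim_cons y : y \notin <<J>>%VS -> (\dim {:vT} - \dim <<y :: J>> < m)%N.
  move=> yJ.
  have : (\dim <<J>> < \dim <<y :: J>>)%N.
    rewrite ltn_neqAle dimvS ?andbT; last first.
      by rewrite span_cons addvSr.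
    have /dimv_leqif_eq/leqifP : (<<J>> <= <<y :: J>>)%VS by rewrite span_cons addvSr.
    case: eqP => [eqJ|_ /ltn_eqF -> //].
    by case/negP: yJ; rewrite eqJ memv_span ?mem_head.
  have : (\dim <<y :: J>> <= \dim {:vT})%N by rewrite dimvS ?subvf.
  by lia.
have consr y : y \in r -> {subset y :: J <= r}.
  by move=> yr t; rewrite inE => /predU1P[->|/Jr].
have [all_r|/allPn[f fr fJ]] := boolP (all [in <<x :: J>>%VS] r); last first.
  (* By induction the classes of [x] modulo [y :: J] and of [y] modulo [x :: J] both have sum 0.
     Their splittings share the terms at [x + y] and [x - y], so the remaining terms, at [x] and at
     [y], agree. *)
  have exch y : y \in r -> y \notin <<x :: J>>%VS ->
      [/\ class_sum <<J>> x + class_sum <<J>> (x + y) + class_sum <<J>> (x - y) = 0 &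
          class_sum <<J>> y = class_sum <<J>> x].
    move=> yr yJ; have xyJ := span_cons_exchange xJ yJ.
    have y'J := notin_span_cons yJ.
    have := class_sum_cons Jr xr yr xJ yJ; have := class_sum_cons Jr yr xr y'J xyJ.
    rewrite (IHm (y :: J)) ?dim_cons //; last by apply: consr.
    rewrite (IHm (x :: J)) ?dim_cons //; last by apply: consr.
    rewrite (addrC y x) (class_sum_eq (x := y - x) (y := x - y)); last first.
      by rewrite /eq_up_to_sign addrA subrK subrr mem0v orbT.
    move=> e1 e2; split; first by [].
    apply: (addIr (class_sum <<J>> (x + y) + class_sum <<J>> (x - y))).
    by rewrite !addrA -e1 -e2.
  have [sum0 _] := exch f fr fJ.
  (* A member [z] of [r] in the class of [x + e f] lies outside the span of [x :: J], so [exch]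
     applies to it; if there is none, the sum is empty. *)
  have zE e : e != 0 -> exists b : bool, class_sum <<J>> (x + e *: f) = class_sum <<J>> x *+ b.
    move=> e0.
    have [/hasP[z zr xfz]|/hasPn none] := boolP (has (eq_up_to_sign <<J>> (x + e *: f)) r).
      exists true; rewrite (class_sum_eq xfz) mulr1n; apply: (exch z zr _).2.
      apply: contra fJ => zJ.
      have xJ1 : x \in <<x :: J>>%VS by rewrite memv_span ?mem_head.
      have JJ1 : (<<J>> <= <<x :: J>>)%VS by rewrite span_cons addvSr.
      suff : e *: f \in <<x :: J>>%VS by rewrite rpredZeq (negPf e0).
      case/orP: xfz => /(subvP JJ1) xfz.
        have -> : e *: f = z - x - (z - (x + e *: f)) by vect_ring.
        exact: memvB (memvB zJ xJ1) xfz.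
      have -> : e *: f = (z + (x + e *: f)) - z - x by vect_ring.
      exact: memvB (memvB xfz zJ) xJ1.
    exists false; rewrite mulr0n /class_sum big1 // => i.
    by rewrite (negPf (none _ (mem_nth 0 (ltn_ord i)))).
  have [b1] := zE 1 (oner_neq0 _); have [b2] := zE (-1) (ltac:(by rewrite oppr_eq0 oner_eq0)).
  rewrite scale1r scaleN1r => E2 E1; move: sum0; rewrite E1 E2.
  rewrite -[X in X + _ + _]mulr1n -!mulrnDr => /eqP; rewrite mulrn_eq0 => /predU1P[|/eqP //].
  by [].
(* Base case: [r] lies in the span of [x :: J]. The values of [phi] on [r] are then 0, 1 or -1, and
   their squares are the indicator of the class of [x], so [squares0] at [phi] is the claim. *)
have [phi [phiJ phix]] := functional_separates xJ.
rewrite -[RHS](squares0 phi) /class_sum big_mkcond /=; apply: eq_bigr => i _.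
have ir := mem_nth 0 (ltn_ord i).
have /mem_span_cons[a aJ] := allP all_r _ ir.
have phia : phi r`_i = a.
  by have := phiJ _ aJ; rewrite linearB linearZ /= phix => /eqP; rewrite subr_eq0 => /eqP ->; rewrite [LHS]mulr1.
rewrite phia; have := unim Jr xr ir xJ aJ; rewrite !inE.
case/or3P=> /eqP a_eq; move: aJ; rewrite a_eq.
- rewrite scale0r subr0 expr0n mulr0 => iJ; case: ifP => // /orP[] xi; case/negP: xJ.
    by have := memvB iJ xi; rewrite opprB addrC subrK.
  by have := memvB xi iJ; rewrite addrC addKr.
- by rewrite scale1r /eq_up_to_sign => ->; rewrite expr1n mulr1.
- by rewrite scaleN1r opprK /eq_up_to_sign orbC => ->; rewrite sqrrN expr1n mulr1.
Qed.

End ClassSums.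
End Unimodular.

(** * Weights on a graph *)

Section Graph.
Variables (F : numFieldType) (vT : vectType F) (V H : finType).
Variables (vert : H -> V) (iota : H -> H) (w : H -> vT).
Hypothesis iotaK : involutive iota.
Hypothesis iota_neq : forall h, iota h != h.

(** An edge is represented by whichever of its two half-edges comes first in the enumeration of
    [H]. *)
Lemma edge_quotient : exists (E : finType) (edge : H -> E),
  [/\ (#|E|.*2 = #|H|)%N, forall h, edge (iota h) = edge h
    & forall e, exists h, edge h = e].
Proof.
pose P h := (enum_rank h < enum_rank (iota h))%N.
have P_iota h : P (iota h) = ~~ P h.
  rewrite /P iotaK -leqNgt [RHS]leq_eqVlt; case: eqP => // /val_inj/enum_rank_inj ih.
  by have := iota_neq h; rewrite ih eqxx.
have edge_ex h : exists e : {h | P h}, (val e == h) || (val e == iota h).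
  have [Ph|Ph] := boolP (P h); first by exists (Sub h Ph); rewrite eqxx.
  have Pih : P (iota h) by rewrite P_iota.
  by exists (Sub (iota h) Pih); rewrite eqxx orbT.
pose edge h := xchoose (edge_ex h).
have edgeP h : (val (edge h) == h) || (val (edge h) == iota h) := xchooseP (edge_ex h).
have edge_uniq h (e : {h | P h}) : val e = h \/ val e = iota h -> edge h = e.
  move=> eh; apply: val_inj.
  have := valP (edge h); have := valP e.
  by case/orP: (edgeP h) => /eqP ->; case: eh => ->; rewrite ?P_iota; case: (P h).
exists {h | P h}, edge; split=> [|h|e].
- rewrite card_sig -addnn -(cardC P); congr (_ + _)%N.
  have memP h : (h \in P) = P h by [].
  rewrite -(card_image (inv_inj iotaK)); apply: eq_card => h; rewrite inE memP.
  apply/imageP/idP => [[k Pk ->]|Ph]; first by rewrite P_iota negbK.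
  by exists (iota h); rewrite ?iotaK // memP P_iota.
- by apply: edge_uniq; rewrite iotaK; case/orP: (edgeP h) => /eqP; [right|left].
- by exists (val e); apply: edge_uniq; left.
Qed.

Hypothesis connV : forall u v, connect (adjV vert iota) u v.
Hypothesis genus : (#|H| + 2 = 2 * (\dim {:vT} + #|V|))%N.
Hypothesis w_iota : forall h, w (iota h) = - w h.
Hypothesis w_vert : forall v, \sum_(h | vert h == v) w h = 0.
Hypothesis w_span : <<[seq w h | h <- enum H]>>%VS = fullv.

Lemma adj_invariant (T : Type) (p : V -> T) :
  (forall h, p (vert h) = p (vert (iota h))) -> forall u v, p u = p v.
Proof.
move=> p_inv u v; have /connectP[s + ->] := connV u v.
elim: s u => //= x s IHs u /andP[/existsP[h /andP[/eqP <- /eqP <-]] /IHs <-].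
exact: p_inv.
Qed.

Lemma sum_vert (p : V -> F) : \sum_h p (vert h) *: w h = 0.
Proof.
rewrite (partition_big vert predT) //= big1 // => v _.
rewrite (eq_bigr (fun h => p v *: w h)); last by move=> h /eqP ->.
by rewrite -scaler_sumr w_vert scaler0.
Qed.

Lemma sum_iota (a : H -> F) :
  \sum_h a (iota h) *: w h = - \sum_h a h *: w h.
Proof.
rewrite (reindex_inj (inv_inj iotaK)) -sumrN; apply: eq_bigr => h _.
by rewrite iotaK w_iota scalerN.
Qed.

(** Functions symmetric under [iota] and functions pulled back from the vertices are relations
    between the weights; a dimension count shows that their sums are all the relations, and
    [a h - a (iota h)] removes the symmetric part. The two kinds share only the constants, by
    connectedness; the extra coordinate [p v0] makes [f] injective. *)
Lemma edge_potential (a : H -> F) (v0 : V) : \sum_h a h *: w h = 0 ->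
  exists p : V -> F, forall h, a h - a (iota h) = p (vert h) - p (vert (iota h)).
Proof.
have [E [edge [cardE edge_iota edge_surj]]] := edge_quotient.
pose fT := ({ffun E -> F^o} * {ffun V -> F^o})%type.
pose gT := ({ffun H -> F^o} * F^o)%type.
pose f (xp : fT) : gT := ([ffun h => xp.1 (edge h) + xp.2 (vert h)], xp.2 v0).
have f_lin : linear f.
  move=> c [x p] [y q]; congr (_, _) => /=; last by rewrite !ffunE.
  by apply/ffunP=> h; rewrite !ffunE /= scalerDr addrACA.
pose fM := GRing.isLinear.Build _ _ _ _ f f_lin.
pose fL : {linear fT -> gT} := HB.pack f fM.
have fE x : linfun fL x = f x by apply: lfunE.
pose g (aq : gT) : vT := \sum_h aq.1 h *: w h.
have g_lin : linear g.
  move=> c [x p] [y q]; rewrite /g scaler_sumr -big_split; apply: eq_bigr => h _.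
  by rewrite !ffunE scalerDl scalerA.
pose gM := GRing.isLinear.Build _ _ _ _ g g_lin.
pose gL : {linear gT -> vT} := HB.pack g gM.
have gE x : linfun gL x = g x by apply: lfunE.
have ker_f : lker (linfun fL) == 0%VS.
  rewrite -subv0; apply/subvP=> -[x p]; rewrite memv_ker fE memv0 => /eqP[].
  move=> /ffunP fxp p0.
  have pE h : p (vert h) = - x (edge h).
    by have := fxp h; rewrite !ffunE /= addrC => /eqP; rewrite addr_eq0 => /eqP.
  have p_cst u : p u = 0.
    rewrite -p0; apply: (adj_invariant (p := p)) => h.
    by rewrite !pE edge_iota.
  apply/eqP; congr (_, _); apply/ffunP=> i; rewrite !ffunE ?p_cst //.
  by have [h <-] := edge_surj i; rewrite -[x _]opprK -pE p_cst oppr0.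
have img_g : limg (linfun gL) = fullv.
  apply/eqP; rewrite eqEsubv subvf /= -w_span; apply/span_subvP=> _ /mapP[h _ ->].
  apply/memv_imgP; exists (([ffun k => (k == h)%:R], 0) : gT); first exact: memvf.
  rewrite gE /g /=.
  rewrite (bigD1 h) //= !ffunE eqxx scale1r big1 ?addr0 // => k /negPf kh.
  by rewrite ffunE kh scale0r.
have fg : (limg (linfun fL) <= lker (linfun gL))%VS.
  apply/subvP=> _ /memv_imgP[[x p] _ ->]; rewrite memv_ker gE fE /= /g /=.
  under eq_bigr do rewrite ffunE scalerDl.
  (* The symmetric part equals its own negative, because [iota] reverses the weights. *)
  rewrite big_split /= sum_vert addr0 -[X in X == _]/(\sum_h (x (edge h)) *: w h).
  have := sum_iota (fun h => x (edge h)); under eq_bigr do rewrite edge_iota.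
  move/eqP; rewrite -addr_eq0 -mulr2n -scaler_nat scaler_eq0 pnatr_eq0 //.
have dim_f := limg_ker_dim (linfun fL) fullv.
have dim_g := limg_ker_dim (linfun gL) fullv.
move: dim_f dim_g; rewrite (eqP ker_f) capv0 dimv0 img_g capfv !dimvf.
rewrite -[dim fT]/(#|E| * 1 + #|V| * 1)%N -[dim gT]/(#|H| * 1 + 1)%N => dim_f dim_g.
move=> a0.
have : (([ffun h => a h], 0) : gT) \in lker (linfun gL).
  by rewrite memv_ker gE /= /g /= -[X in _ == X]a0; apply/eqP/eq_bigr => h _; rewrite ffunE.
(* As [2|E| = |H|], the genus formula reads [|E| + |V| = |H| + 1 - dim vT], so the inclusion [fg] is
   an equality. *)
have -> : lker (linfun gL) = limg (linfun fL).
  apply/eqP; rewrite eq_sym eqEdim fg andTb.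
  move: genus dim_f dim_g cardE; rewrite dimvf; lia.
case/memv_imgP=> -[x p] _; rewrite fE => -[/ffunP ap _]; exists p => h.
have := ap h; have := ap (iota h); rewrite !ffunE /= edge_iota => -> ->.
by rewrite opprD addrACA subrr add0r.
Qed.

(** Coefficients are indexed by half-edges, as [edge_potential] requires; distinct half-edges may
    carry the same weight. *)
Lemma mem_span_map (s : seq H) (u : vT) : u \in <<map w s>>%VS ->
  exists c : H -> F, (forall h, h \notin s -> c h = 0) /\ u = \sum_h c h *: w h.
Proof.
elim: s u => [|k s IHs] u /=.
  rewrite span_nil memv0 => /eqP ->; exists (fun=> 0); split=> //.
  by rewrite big1 // => h _; rewrite scale0r.
case/mem_span_cons=> b /IHs[c [c0 uE]]; exists (fun h => c h + b * (h == k)%:R).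
split=> [h|]; first by rewrite inE negb_or => /andP[/negPf -> /c0 ->]; rewrite mulr0 addr0.
rewrite (eq_bigr (fun h => c h *: w h + (b * (h == k)%:R) *: w h)); last first.
  by move=> h _; rewrite scalerDl.
rewrite big_split -uE (bigD1 k) //= eqxx mulr1 big1 ?addr0 ?subrK // => h /negPf ->.
by rewrite mulr0 scale0r.
Qed.

(* The coefficients of [y - a x - u = 0] come from a potential [p], and the
   indicator of a level set of [p] avoiding the ends of the edge of [y] would
   express [x] through [J] unless [p] agrees at both ends of the edge of [x]. *)
Lemma unimodular_weights : unimodular [pred x | [exists h, w h == x]].
Proof.
move=> J x y a JR /existsP[hx /eqP <-] /existsP[hy /eqP <-] xJ yaxJ.
have [s JE] : exists s, J = map w s.
  elim: J JR {xJ yaxJ} => [|u J IHJ] JR; first by exists [::].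
  have [|s ->] := IHJ; first by move=> v vJ; apply: JR; rewrite inE vJ orbT.
  have /existsP[h /eqP <-] := JR _ (mem_head u J).
  by exists (h :: s).
have wJ h : (h \in s) || (iota h \in s) -> w h \in <<J>>%VS.
  rewrite JE; case/orP=> hs; first by rewrite memv_span ?map_f.
  by rewrite -[w h]opprK -w_iota memvN memv_span ?map_f.
have xs : (hx \in s) || (iota hx \in s) = false by apply: contraNF xJ => /wJ.
have scale_xJ b : b *: w hx \in <<J>>%VS -> b = 0.
  by rewrite rpredZeq (negPf xJ) orbF => /eqP.
(* Degenerate positions come first: the edge of [hy] meets [s], or it is the edge of [hx]. *)
have [/wJ yJ|ys] := boolP ((hy \in s) || (iota hy \in s)).
  suff -> : a = 0 by rewrite inE eqxx.
  apply: scale_xJ; have -> : a *: w hx = w hy - (w hy - a *: w hx) by vect_ring.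
  exact: memvB.
have [hyx|hyx] := eqVneq hy hx.
  suff /eqP : 1 - a = 0 by rewrite subr_eq0 => /eqP <-; rewrite !inE eqxx orbT.
  by apply: scale_xJ; rewrite scalerBl scale1r -{1}hyx.
have [hyix|hyix] := eqVneq hy (iota hx).
  suff /eqP : - 1 - a = 0 by rewrite subr_eq0 => /eqP <-; rewrite !inE eqxx !orbT.
  by apply: scale_xJ; rewrite scalerBl scaleN1r -w_iota -{1}hyix.
have [ihyx ihyix] : iota hy != hx /\ iota hy != iota hx.
  by rewrite (inj_eq (inv_inj iotaK)) -(inj_eq (inv_inj iotaK)) iotaK.
rewrite JE in yaxJ; have {yaxJ} [c [c0 yE]] := mem_span_map yaxJ.
case/norP: ys => ys iys; case/norP: (negbT xs) => xs1 ixs.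
pose b h := (h == hy)%:R - a * (h == hx)%:R - c h.
have delta k : \sum_h (h == k)%:R *: w h = w k :> vT.
  rewrite (bigD1 k) //= eqxx scale1r big1 ?addr0 // => h /negPf ->.
  by rewrite scale0r.
have sum_b : \sum_h b h *: w h = 0.
  rewrite (eq_bigr (fun h => (h == hy)%:R *: w h - a *: ((h == hx)%:R *: w h) - c h *: w h)).
    by rewrite !big_split /= !sumrN -scaler_sumr !delta -yE subrr.
  by move=> h _; rewrite /b !scalerBl scalerA.
have [p pE] := edge_potential (vert hx) sum_b.
have p_x : p (vert hx) - p (vert (iota hx)) = - a.
  rewrite -pE /b !eqxx (negPf (iota_neq hx)) !(c0 _) //.
  rewrite [hx == hy]eq_sym (negPf hyx) [iota hx == hy]eq_sym (negPf hyix).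
  by rewrite /=; ring.
have p_y : p (vert hy) - p (vert (iota hy)) = 1.
  rewrite -pE /b !eqxx (negPf (iota_neq hy)) !(c0 _) //.
  by rewrite (negPf hyx) (negPf ihyx) /=; ring.
have level z : z != p (vert hy) -> z != p (vert (iota hy)) ->
    (p (vert hx) == z) = (p (vert (iota hx)) == z).
  move=> zy ziy; pose q h : F := (p (vert h) == z)%:R.
  pose d h := q h - q (iota h).
  have sum_d : \sum_h d h *: w h = 0.
    rewrite (eq_bigr (fun h => q h *: w h - q (iota h) *: w h)); last first.
      by move=> h _; rewrite /d scalerBl.
    by rewrite big_split /= sumrN sum_iota (sum_vert (fun v => (p v == z)%:R)) !oppr0 addr0.
  (* On an edge other than those of [hx], [hy] and [s], [p] takes equal values at both ends; on the
     edge of [hy] neither end lies in the level set of [z]. *)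
  have d0 h : h != hx -> h != iota hx -> d h *: w h \in <<J>>%VS.
    move=> hhx hihx; have [hs|/norP[hs ihs]] := boolP ((h \in s) || (iota h \in s)).
      exact: memvZ (wJ _ hs).
    suff -> : d h = 0 by rewrite scale0r mem0v.
    rewrite /d /q; have [->|hhy] := eqVneq h hy.
      by rewrite ![_ == z]eq_sym (negPf zy) (negPf ziy) subrr.
    have [->|hihy] := eqVneq h (iota hy).
      by rewrite iotaK ![_ == z]eq_sym (negPf zy) (negPf ziy) subrr.
    suff -> : p (vert h) = p (vert (iota h)) by rewrite subrr.
    apply/eqP; rewrite -subr_eq0 -pE /b (negPf hhx) (negPf hhy) !(c0 _) //.
    rewrite -[iota h == hy](inj_eq (inv_inj iotaK)) -[iota h == hx](inj_eq (inv_inj iotaK)).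
    by rewrite iotaK (negPf hihx) (negPf hihy) subrr.
  (* Both [d] and [w] change sign under [iota], so the two halves of the edge of [hx] contribute
     equally. *)
  have : (d hx *+ 2) *: w hx \in <<J>>%VS.
    have -> : (d hx *+ 2) *: w hx = d hx *: w hx + d (iota hx) *: w (iota hx).
      by rewrite /d iotaK w_iota scalerN -scaleNr opprB -mulr2n scalerMnl.
    move: sum_d; rewrite (bigD1 hx) // (bigD1 (iota hx)) ?iota_neq //= addrA => /eqP.
    rewrite addr_eq0 => /eqP ->; rewrite memvN memv_suml // => h /andP[].
    exact: d0.
  move/scale_xJ/eqP; rewrite mulrn_eq0 /= /d /q subr_eq0 eqr_nat.
  by do 2!case: (_ == z).
rewrite !inE; have [//|a0] := eqVneq a 0.
have pxx : p (vert hx) != p (vert (iota hx)) by rewrite -subr_eq0 p_x oppr_eq0.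
have ends k : k = hx \/ k = iota hx ->
    p (vert k) = p (vert hy) \/ p (vert k) = p (vert (iota hy)).
  move=> kx; have [|zy] := eqVneq (p (vert k)) (p (vert hy)); first by left.
  have [|ziy] := eqVneq (p (vert k)) (p (vert (iota hy))); first by right.
  have := level _ zy ziy.
  by case: kx => ->; rewrite eqxx; [rewrite eq_sym|]; rewrite (negPf pxx).
(* The potential differs at the ends of the edge of [hx] and takes there the two values of the edge
   of [hy]; hence [-a] is 1 or -1. *)
have [pP|pQ] := ends hx (or_introl erefl); have [iP|iQ] := ends _ (or_intror erefl).
- by rewrite pP iP eqxx in pxx.
- by move: p_x; rewrite pP iQ p_y => /eqP; rewrite eq_sym eqr_oppLR => ->; rewrite orbT.
- by move: p_x; rewrite pQ iP -opprB p_y => /oppr_inj <-; rewrite eqxx.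
- by rewrite pQ iQ eqxx in pxx.
Qed.
End Graph.

(** * Tensors and the trace pairing *)

Section Tensors.
Variable L : fieldExtType rat.
Local Notation d := (\dim {:L}).
Local Notation e := (eF L).

Lemma eF_basis : basis_of fullv e.
Proof. exact: vbasisP. Qed.

Lemma coord_eF (x : L) : x = \sum_i coord e i x *: e`_i.
Proof. exact: coord_vbasis (memvf x). Qed.

(** Modulo the zero space the class of [r_i] is reduced to the index [i], so [class_sum0] with empty
    [J] gives [c i = 0]. *)
Lemma free_squares (r : seq L) : unimodular (mem r) ->
  (forall x, x \in r -> x != 0) ->
  (forall i j, (i < size r)%N -> (j < size r)%N ->
     (r`_i = r`_j \/ r`_i = - r`_j) -> i = j) ->
  free [seq tens x x | x <- r].
Proof.
move=> unim r0 r_uniq; pose X := map_tuple (fun x => tens x x) (in_tuple r).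
apply: (introT (@freeP _ _ _ X)) => c cX i.
have squares0 (phi : 'Hom(L, rat^o)) : \sum_(i < size r) c i * phi r`_i ^+ 2 = 0.
  have phiE x : phi x ^+ 2 = \sum_j \sum_k tens x x j k * (phi e`_j * phi e`_k).
    have {1}-> : phi x = \sum_j coord e j x * phi e`_j.
      by rewrite {1}[x]coord_eF linear_sum; apply: eq_bigr => j _; rewrite linearZ.
    rewrite expr2 mulr_suml; apply: eq_bigr => j _.
    rewrite mulr_sumr; apply: eq_bigr => k _; rewrite mxE; ring.
  transitivity (\sum_j \sum_k (\sum_(i < size r) c i *: X`_i) j k * (phi e`_j * phi e`_k)).
    under eq_bigr do rewrite phiE mulr_sumr.
    rewrite exchange_big; apply: eq_bigr => j _.
    under eq_bigr do rewrite mulr_sumr.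
    rewrite exchange_big; apply: eq_bigr => k _.
    rewrite summxE mulr_suml; apply: eq_bigr => l _.
    by rewrite [in RHS]mxE (nth_map 0) // mulrA.
  by rewrite cX big1 // => j _; rewrite big1 // => k _; rewrite mxE mul0r.
have ri : r`_i \in r := mem_nth 0 (ltn_ord i).
have <- : class_sum c <<[::]>> r`_i = c i; last first.
  by apply: (class_sum0 unim squares0) => //; rewrite span_nil memv0 r0.
rewrite /class_sum (big_pred1 i) // => j.
rewrite /eq_up_to_sign span_nil !memv0 subr_eq0 addr_eq0.
apply/idP/eqP => [ji|->]; last by rewrite eqxx.
apply/val_inj/(r_uniq _ _ (ltn_ord j) (ltn_ord i)).
by case/orP: ji => /eqP; [left|right].
Qed.

(** * Nondegeneracy of the trace form *)

Lemma trF_linear : linear (@trF L : L -> rat^o).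
Proof.
move=> a x y; rewrite /trF amulr_is_linear passmx.mxof_linear.
by rewrite mxtraceD mxtraceZ.
Qed.

Lemma trF1 : trF (1 : L) = d%:R.
Proof.
rewrite /trF (amulr_is_monoid_morphism L).1 passmx.mxof1 ?mxtrace1 //.
exact: basis_free eF_basis.
Qed.

HB.instance Definition _ := GRing.isLinear.Build rat L rat^o _ (@trF L) trF_linear.

Lemma trFZ a (x : L) : trF (a *: x) = a * trF x.
Proof. exact: linearZ. Qed.

Lemma trF_sum (I : finType) (f : I -> L) : trF (\sum_i f i) = \sum_i trF (f i).
Proof. exact: raddf_sum. Qed.

Definition trace_gram : 'M[rat]_d := \matrix_(i, j) trF (e`_i * e`_j).

(** A nonzero [x] in the radical would give [trF (x * x^-1) = 0], whereas [trF 1] is the degree. *)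
Lemma row_free_trace_gram : row_free trace_gram.
Proof.
apply: inj_row_free => v vG; pose x := \sum_i v 0 i *: e`_i.
have x_orth y : trF (x * y) = 0.
  rewrite [y]coord_eF mulr_sumr trF_sum big1 // => k _.
  rewrite -scalerAr trFZ mulr_suml trF_sum.
  suff -> : \sum_i trF (v 0 i *: e`_i * e`_k) = (v *m trace_gram) 0 k.
    by rewrite vG mxE mulr0.
  by rewrite mxE; apply: eq_bigr => i _; rewrite -scalerAl trFZ mxE.
have x0 : x = 0.
  apply/eqP; apply/negPn/negP => x0.
  have := x_orth x^-1; rewrite mulfV // trF1 => /eqP.
  by rewrite pnatr_eq0 dimv_eq0 -subv0 => /subvP/(_ _ (memvf 1)); rewrite memv0 oner_eq0.
apply/rowP=> i; rewrite mxE.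
by have := freeP (basis_free eF_basis) _ x0 i.
Qed.

(** * Dimension of annihilators *)

Lemma tpairE (T U : 'M[rat]_d) :
  tpair T U = \sum_i \sum_j T i j * (trace_gram *m U *m trace_gram^T) i j.
Proof.
apply: eq_bigr => i _; apply: eq_bigr => j _; rewrite mxE.
under [in RHS]eq_bigr do rewrite mxE mulr_suml.
rewrite exchange_big mulr_sumr; apply: eq_bigr => k _.
rewrite mulr_sumr; apply: eq_bigr => l _; rewrite !mxE; ring.
Qed.

Lemma tpair_sumr (I : finType) (c : I -> rat) (f : I -> 'M[rat]_d) T :
  tpair T (\sum_i c i *: f i) = \sum_i c i * tpair T (f i).
Proof.
under [RHS]eq_bigr do rewrite tpairE mulr_sumr.
rewrite tpairE [RHS]exchange_big; apply: eq_bigr => i _.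
under [RHS]eq_bigr do rewrite mulr_sumr.
rewrite [RHS]exchange_big; apply: eq_bigr => j _.
rewrite mulmx_sumr mulmx_suml summxE mulr_sumr; apply: eq_bigr => k _.
by rewrite -scalemxAr -scalemxAl mxE mulrCA.
Qed.

Local Notation pairing s := (fun T : 'M[rat]_d => \row_(i < size s) tpair T s`_i).

Lemma tpair_linearl s : linear (pairing s).
Proof.
move=> a T U; apply/rowP=> i; rewrite !mxE !tpairE mulr_sumr -big_split.
apply: eq_bigr => j _; rewrite mulr_sumr -big_split; apply: eq_bigr => k _.
by rewrite /= [(a *: T + U) j k]mxE [(a *: T) j k]mxE; ring.
Qed.

Lemma pairingE s T : linfun (pairing s) T = pairing s T.
Proof.
pose fM := GRing.isLinear.Build _ _ _ _ (pairing s) (tpair_linearl s).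
pose fL : {linear 'M[rat]_d -> 'rV[rat]_(size s)} := HB.pack (pairing s) fM.
exact: (lfunE fL).
Qed.

Lemma mem_annV s (T : 'M[rat]_d) :
  reflect (forall U, U \in <<s>>%VS -> tpair T U = 0) (T \in annV s).
Proof.
rewrite memv_ker pairingE; apply: (iffP eqP) => [/rowP Ts U Us | Ts].
  have {Us} -> := coord_span (X := in_tuple s) Us.
  rewrite tpair_sumr big1 // => i _.
  by have := Ts i; rewrite !mxE => ->; rewrite mulr0.
by apply/rowP=> i; rewrite !mxE Ts // memv_span ?mem_nth.
Qed.

(** The Gram matrix [G] is invertible, so [U -> G U G^T] preserves independence. The functionals
    given by [s] are therefore independent, and rank-nullity applies in the space of all
    matrices. *)
Lemma dim_annV (s : seq 'M[rat]_d) : free s -> (\dim (annV s) + size s = d * d)%N.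
Proof.
move=> free_s.
pose B := \matrix_(i < size s) mxvec (trace_gram *m s`_i *m trace_gram^T).
have B_free : row_free B.
  apply: inj_row_free => y yB.
  have : trace_gram *m (\sum_i y 0 i *: s`_i) *m trace_gram^T = 0.
    apply: (can_inj mxvecK); rewrite linear0 -yB mulmx_sum_row.
    rewrite mulmx_sumr mulmx_suml linear_sum; apply: eq_bigr => i _ /=.
    by rewrite -scalemxAr -scalemxAl linearZ rowK.
  have unitG : trace_gram \in unitmx by rewrite -row_free_unit row_free_trace_gram.
  move/(congr1 (fun M => invmx trace_gram *m M *m invmx trace_gram^T)).
  rewrite !mulmxA mulVmx // mul1mx mulmxK ?unitmx_tr // mulmx0 mul0mx => s0.
  by apply/rowP=> i; rewrite mxE; apply: (freeP (X := in_tuple s) free_s _ s0).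
have [B' BB'] := row_freeP B_free.
have img : limg (linfun (pairing s)) = fullv.
  apply/eqP; rewrite eqEsubv subvf /=; apply/subvP=> y _; apply/memv_imgP.
  (* Pairing amounts to multiplying by [B^T], and the right inverse [B'] of [B] supplies the
     preimage of [y]. *)
  exists (vec_mx (y *m B'^T)); rewrite ?memvf // pairingE; apply/rowP=> i.
  rewrite mxE tpairE.
  have -> : y 0 i = (y *m B'^T *m B^T) 0 i by rewrite -mulmxA -trmx_mul BB' trmx1 mulmx1.
  rewrite mxE; set z := y *m B'^T.
  rewrite pair_big [LHS](reindex _ (curry_mxvec_bij _ _)) /=.
  by apply: eq_bigr => -[j k] _; rewrite [vec_mx _ _ _]mxE [B^T _ _]mxE [B _ _]mxE mxvecE.
have := limg_ker_dim (linfun (pairing s)) fullv.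
have dM : \dim {:'M[rat]_d} = (d * d)%N by rewrite dimvf dim_matrix.
have dR : \dim {:'rV[rat]_(size s)} = size s by rewrite dimvf; apply: mul1n.
by rewrite capfv img dM dR.
Qed.

(** * Dimension of the antisymmetric tensors *)

Lemma tens_eF (i j : 'I_d) : tens e`_i e`_j = delta_mx i j.
Proof.
have eb := basis_free eF_basis.
by apply/matrixP=> k l; rewrite !mxE !coord_free // -natrM mulnb ![_ == k]eq_sym ![_ == l]eq_sym.
Qed.

(** The differences [delta_mx i j - delta_mx j i] with [i < j] form a basis. *)
Lemma dim_asymV : (\dim (asymV L) + (d * (d + 1)) %/ 2 = d * d)%N.
Proof.
pose P := [set p : 'I_d * 'I_d | (p.1 < p.2)%N].
pose D (p : 'I_d * 'I_d) : 'M[rat]_d := delta_mx p.1 p.2 - delta_mx p.2 p.1.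
pose X := map_tuple D (in_tuple (enum P)).
have XE : asymV L = <<X>>%VS.
  apply/eqP; rewrite eqEsubv; apply/andP; split; apply/span_subvP=> A.
    case/allpairsP=> -[i j] [_ _ ->] /=; rewrite !tens_eF.
    case: (ltngtP i j) => ij.
    - by apply/memv_span/mapP; exists (i, j); rewrite ?mem_enum ?inE.
    - rewrite -opprB memvN; apply/memv_span/mapP.
      by exists (j, i); rewrite ?mem_enum ?inE.
    - by rewrite (val_inj ij) subrr mem0v.
  case/mapP=> -[i j] _ ->; rewrite /D /= -!tens_eF; apply/memv_span/allpairsP.
  by exists (i, j); rewrite !mem_enum.
have freeX : free X.
  apply: (introT (@freeP _ _ _ X)) => c cX k.
  pose p := tnth (in_tuple (enum P)).
  have p_inj : injective p by apply/tuple_uniqP/enum_uniq.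
  have p_lt l : ((p l).1 < (p l).2)%N.
    by have := mem_tnth l (in_tuple (enum P)); rewrite mem_enum inE.
  have XE' (l : 'I_(size (enum P))) : X`_l = D (p l) by rewrite -tnth_nth tnth_map.
  (* The entry of the relation at [p k], above the diagonal, involves only [c k]. *)
  have := congr1 (fun M : 'M[rat]_d => M (p k).1 (p k).2) cX.
  rewrite summxE mxE (bigD1 k) //= big1 => [|l lk]; rewrite XE' !mxE.
    rewrite !eqxx addr0 /=; case: (_ =P (p k).2) => [eq12|_]; last by rewrite subr0 mulr1.
    by have := p_lt k; rewrite eq12 ltnn.
  have -> : ((p k).1 == (p l).1) && ((p k).2 == (p l).2) = false.
    by rewrite -xpair_eqE -!surjective_pairing (inj_eq p_inj) eq_sym (negPf lk).
  case: andP => [[/eqP e1 /eqP e2]|_]; last by rewrite subrr mulr0.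
  by have := p_lt k; rewrite e1 e2 ltnNge (ltnW (p_lt l)).
have dimX : (\dim (asymV L) = #|P|)%N by rewrite XE (eqnP freeX) size_tuple -cardE.
pose swap (p : 'I_d * 'I_d) := (p.2, p.1).
pose diag (i : 'I_d) := (i, i).
have cardP : (#|P| + #|P| + d = d * d)%N.
  have swapK : involutive swap by case.
  (* Pairs outside [P] are swapped pairs of [P] or diagonal. *)
  have cP : #|~: P| = (#|swap @: P| + #|diag @: 'I_d|)%N.
    rewrite -cardsUI.
    have -> : swap @: P :&: diag @: 'I_d = set0.
      apply/setP=> -[i j]; rewrite !inE; apply/andP=> -[/imsetP[[k l]]].
      by rewrite inE /= => kl [-> ->] /imsetP[m _ [lm km]]; rewrite lm km ltnn in kl.
    rewrite cards0 addn0; apply: eq_card => -[i j]; rewrite !inE /= -leqNgt.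
    apply/idP/orP => [|[/imsetP[[k l]]|/imsetP[k _ [-> ->]]]]; last exact: leqnn.
      rewrite leq_eqVlt => /orP[/eqP/val_inj ->|ji]; first by right; apply/imsetP; exists i.
      by left; apply/imsetP; exists (j, i); rewrite ?inE.
    by rewrite inE /= => kl [-> ->]; apply: ltnW.
  have diag_inj : injective diag by move=> i j [].
  rewrite (card_imset _ (inv_inj swapK)) (card_imset _ diag_inj) card_ord in cP.
  by rewrite -addnA -cP cardsC card_prod card_ord.
by rewrite dimX; lia.
Qed.

End Tensors.

(** * Application to weighted stable curves *)

Lemma span_weights (L : fieldExtType rat) (H : finType) (w : H -> L)
    (b : (\dim {:L}).-tuple L) : basis_of fullv b ->
  (forall x, inIntSpan (in_tuple (map w (enum H))) x <-> inIntSpan b x) ->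
  <<map w (enum H)>>%VS = fullv.
Proof.
move=> b_basis wb; apply/eqP; rewrite eqEsubv subvf /= -(span_basis b_basis).
apply/span_subvP=> _ /tnthP[i ->].
have /wb[a ->] : inIntSpan b (tnth b i).
  exists [ffun j => (j == i)%:R]; rewrite (bigD1 i) //= ffunE eqxx -tnth_nth.
  by rewrite big1 ?addr0 // => j /negPf ji; rewrite ffunE ji mulr0z.
apply: memv_suml => j _; rewrite -scaler_int memvZ //.
by apply/memv_span/mem_nth.
Qed.

Lemma unimodular_sub (F : numFieldType) (vT : vectType F) (R R' : {pred vT}) :
  {subset R <= R'} -> unimodular R' -> unimodular R.
Proof.
by move=> RR' U J x y a JR xR yR; apply: U; rewrite ?RR' // => u /JR/RR'.
Qed.

Lemma eq_annV (L : fieldExtType rat) (s t : seq 'M[rat]_(\dim {:L})) :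
  <<s>>%VS = <<t>>%VS -> annV s = annV t.
Proof.
move=> st; apply/vspaceP=> T.
by apply/mem_annV/mem_annV => T0 U; [rewrite -st | rewrite st]; apply: T0.
Qed.

Theorem theorem3p1 (L : fieldExtType rat) (g : nat)
  (V H : finType) (vert : H -> V) (iota : H -> H) (w : H -> L) (r : seq L) :
  \dim {:L} = g ->
  totally_real L ->
  weighted_stable_curve g vert iota w ->
  (* r lists the distinct (nonzero) weights up to sign *)
  (forall x, x \in r -> x != 0) ->
  (forall i j, (i < size r)%N -> (j < size r)%N ->
     (r`_i = r`_j \/ r`_i = - r`_j) -> i = j) ->
  (forall x, x \in r -> exists h, w h = x) ->
  (forall h, w h != 0 -> exists2 x, x \in r & (w h = x \/ w h = - x)) ->
  free [seq tens x x | x <- r] /\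
  (* dim N(S) = dim annV(W) - dim asymV = g(g+1)/2 - n *)
  (\dim (annV (weight_squares w)) + size r =
     \dim (asymV L) + (g * (g + 1)) %/ 2)%N.
Proof.
move=> dimL _ [[iotaK iota_neq] connV _ genus [w_iota w_vert [b [b_basis wb]]]].
move=> r0 r_uniq r_w w_r.
have w_span := span_weights b_basis wb.
rewrite -dimL in genus.
have unim : unimodular (mem r).
  have := unimodular_weights iotaK iota_neq connV genus w_iota w_vert w_span.
  apply: unimodular_sub.
  by move=> x /r_w[h <-]; apply/existsP; exists h.
have free_r := free_squares unim r0 r_uniq.
split=> //.
(* Opposite weights have the same square and the weight 0 contributes nothing. *)
have spanE : <<weight_squares w>>%VS = <<[seq tens x x | x <- r]>>%VS.
  apply/eqP; rewrite eqEsubv; apply/andP; split; apply/span_subvP=> T /mapP[].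
    move=> h _ ->; have [->|/w_r[x xr wx]] := eqVneq (w h) 0.
      suff -> : tens (0 : L) 0 = 0 by apply: mem0v.
      by apply/matrixP=> i j; rewrite !mxE linear0 mul0r.
    suff -> : tens (w h) (w h) = tens x x by apply/memv_span/map_f.
    case: wx => -> //; apply/matrixP=> i j.
    by rewrite !mxE !linearN mulrNN.
  move=> x /r_w[h <-] ->; apply/memv_span/mapP.
  by exists h; rewrite ?mem_enum.
(* Both sides equal [d * d], the dimension of the full tensor square. *)
rewrite (eq_annV spanE); have := dim_annV free_r; have := dim_asymV L.
by rewrite size_map -dimL => -> ->.
Qed.
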